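(* Let $\gamma(t)=(\cos t,\sin t)$. (1) Let $\alpha\in(0,\pi)$. A non-trivial infinitesimal deformation of $\gamma$ within the class of self-Bäcklund $\pi$-anti-periodic centroaffine curves, with rotation number $\tilde\alpha=\alpha+\varepsilon\alpha_1$ for some $\alpha_1\in\mathbb{R}$, exists if and only if either $\alpha=\pi/2$, or $\alpha\ne\pi/2$ and $\alpha$ satisfies the equation $$\tan(k\alpha)=k\tan\alpha$$ for some integer $k\ge4$. (2) For every integer $k\ge2$ there are exactly $k-2$ solutions of the equation $\tan(k\alpha)=k\tan\alpha$ in the interval $(0,\pi)$, counting also $\alpha=\pi/2$ as a solution for $k$ odd.
   Context: For $u,v\in\mathbb{R}^2$, $[u,v]$ denotes the determinant of the matrix with columns $u,v$. A centroaffine curve is a smooth curve $\gamma:\mathbb{R}\to\mathbb{R}^2$ with $[\gamma,\gamma']=1$; it is $\pi$-anti-periodic if $\gamma(t+\pi)=-\gamma(t)$. It is self-Bäcklund with rotation number $\alpha\in(0,\pi)$ if $[\gamma(t),\gamma(t+\alpha)]=c$ for all $t$, for some constant $c\neq0$. An infinitesimal deformation of such a $\gamma$ (within this class) is a formal expression $\tilde\gamma=\gamma(t)+\varepsilon\gamma_1(t)$, with $\gamma_1$ smooth and $\pi$-anti-periodic, satisfying modulo $\varepsilon^2$ the equations $[\tilde\gamma,\tilde\gamma']=1$ and $[\tilde\gamma(t),\tilde\gamma(t+\tilde\alpha)]=\tilde c$ for some $\tilde\alpha=\alpha+\varepsilon\alpha_1$, $\tilde c=c+\varepsilon c_1$ with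 $\alpha_1,c_1\in\mathbb{R}$ constants. It is trivial if it is induced by a shift of the argument, $\tilde\gamma=\gamma(t+a\varepsilon)$ with $a\in\mathbb{R}$, or by the action of $\mathrm{SL}_2(\mathbb{R})$, $\tilde\gamma=e^{\varepsilon A}\gamma(t)$ with $A\in\mathfrak{sl}_2(\mathbb{R})$ (both modulo $\varepsilon^2$). *)

(* Defs.v *)
From Stdlib Require Import Reals List Arith Factorial.
From Coquelicot Require Import Coquelicot.
Open Scope R_scope.

Definition det2 (u v : R * R) : R := fst u * snd v - snd u * fst v.

Definition smooth_curve (g : R -> R * R) : Prop :=
  forall (n : nat) (t : R),
    ex_derive_n (fun s => fst (g s)) n t /\ ex_derive_n (fun s => snd (g s)) n t.

Definition velocity (g : R -> R * R) (t : R) : R * R :=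
  (Derive (fun s => fst (g s)) t, Derive (fun s => snd (g s)) t).

Definition centroaffine (g : R -> R * R) : Prop :=
  smooth_curve g /\ forall t, det2 (g t) (velocity g t) = 1.

Definition antiperiodic (g : R -> R * R) : Prop :=
  forall t, g (t + PI) = opp (g t).

Definition self_backlund (g : R -> R * R) (alpha c : R) : Prop :=
  centroaffine g /\ antiperiodic g /\ 0 < alpha < PI /\ c <> 0 /\
  forall t, det2 (g t) (g (t + alpha)) = c.

(** Congruence modulo [eps^2] of two expressions in [eps]: their difference is
    O(eps^2) as [eps] tends to 0.  For smooth curves both sides are smooth in [eps],
    so this says that their first-order Taylor polynomials coincide. *)
Definition eq_mod_eps2 (F G : R -> R) : Prop :=
  exists M : R, locally 0 (fun eps => Rabs (F eps - G eps) <= M * eps ^ 2).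

Definition eq_mod_eps2_plane (F G : R -> R * R) : Prop :=
  eq_mod_eps2 (fun eps => fst (F eps)) (fun eps => fst (G eps)) /\
  eq_mod_eps2 (fun eps => snd (F eps)) (fun eps => snd (G eps)).

Definition deformed (g g1 : R -> R * R) (eps t : R) : R * R :=
  plus (g t) (scal eps (g1 t)).

(** [g1] stands for the formal expression [g + eps g1]. *)
Definition infinitesimal_deformation
    (g : R -> R * R) (alpha : R) (g1 : R -> R * R) : Prop :=
  smooth_curve g1 /\ antiperiodic g1 /\
  (forall t, eq_mod_eps2
     (fun eps => det2 (deformed g g1 eps t) (velocity (deformed g g1 eps) t))
     (fun _ => 1)) /\
  exists c alpha1 c1 : R,
    self_backlund g alpha c /\
    forall t, eq_mod_eps2
      (fun eps => det2 (deformed g g1 eps t)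
                       (deformed g g1 eps (t + (alpha + eps * alpha1))))
      (fun eps => c + eps * c1).

Definition mat2 := @matrix_Ring R_Ring 2.

Definition entry (A : mat2) (i j : nat) : R := coeff_mat (0 : R) A i j.

Definition in_sl2 (A : mat2) : Prop := entry A 0 0 + entry A 1 1 = 0.

(** The matrix [exp (eps A)], by its power series taken entrywise;
    [pow_n] is the power in the ring of 2 x 2 matrices. *)
Definition exp_mat (eps : R) (A : mat2) : mat2 :=
  mk_matrix 2 2 (fun i j =>
    PSeries (fun n => entry (pow_n A n) i j / INR (fact n)) eps).

Definition mat_act (A : mat2) (v : R * R) : R * R :=
  (entry A 0 0 * fst v + entry A 0 1 * snd v,
   entry A 1 0 * fst v + entry A 1 1 * snd v).

Definition induced_by_shift (g g1 : R -> R * R) : Prop :=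
  exists a : R, forall t,
    eq_mod_eps2_plane (fun eps => deformed g g1 eps t) (fun eps => g (t + a * eps)).

Definition induced_by_sl2 (g g1 : R -> R * R) : Prop :=
  exists A : mat2, in_sl2 A /\ forall t,
    eq_mod_eps2_plane (fun eps => deformed g g1 eps t)
                      (fun eps => mat_act (exp_mat eps A) (g t)).

Definition trivial_deformation (g g1 : R -> R * R) : Prop :=
  induced_by_shift g g1 \/ induced_by_sl2 g g1.

Definition circle (t : R) : R * R := (cos t, sin t).

(** [tan (k alpha) = k tan alpha], both sides being defined: in Stdlib [tan] is
    the total function [sin / cos], whose value where [cos] vanishes is junk. *)
Definition tan_equation (k : nat) (alpha : R) : Prop :=
  cos alpha <> 0 /\ cos (INR k * alpha) <> 0 /\
  tan (INR k * alpha) = INR k * tan alpha.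

(* Main.v *)
Require Import Defs.
From Stdlib Require Import Reals List.
From Coquelicot Require Import Coquelicot.
From Stdlib Require Import Arith Classical Lra Lia.
Open Scope R_scope.

(** Write a deformation of the circle in the moving frame,
    [g1 = r gamma + h gamma'], with [r] and [h] of period [PI].  To first order in
    [eps], the condition [[gamma, gamma'] = 1] says that [h' = - 2 r], and the second
    condition says that
      [sin alpha (r t + r (t + alpha)) + cos alpha (h (t + alpha) - h t)]
    does not depend on [t].  Translations act diagonally on Fourier modes, so this
    equation decouples: the [n]-th harmonic of [h] is multiplied by
      [dispersion n alpha = n sin alpha cos (n alpha) - cos alpha sin (n alpha)],
    hence vanishes unless [dispersion n alpha = 0] ([linearized_harmonics]).  Away from
    [alpha = PI / 2] the latter is the equation [tan (n alpha) = n tan alpha]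
    ([tan_equation_iff_dispersion]); at [PI / 2] it holds exactly for odd [n].

    The harmonics 0 and 1 are always allowed: they make up a three-dimensional space,
    which is the linear fields [A gamma] with [A] in sl2 ([first_harmonic_trivial]).
    Shifts are rotations and bring nothing new.  A deformation without harmonics of
    index at least 2 is therefore trivial, which uses the completeness of the
    trigonometric system ([harmonics_0_eq_0], [low_harmonics]).  Conversely, a zero of
    [dispersion k] with [3 <= k] makes [h = cos (2 k t)] a deformation, and it is not a
    linear field ([circle_deformation_nontrivial]).

    For the count, the derivative of [dispersion k] is
    [(1 - k ^ 2) sin x sin (k x)], so that [dispersion k] is monotone on each cell
    [[j PI / k, (j + 1) PI / k]].  It vanishes at [0] and [PI], which excludes zeros
    inside the two extreme cells, and its values at the inner grid points alternate in
    sign, which gives exactly one zero in each of the other [k - 2] cells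
    ([dispersion_zeros]).  For [k = 2] this leaves no zero, and for [k = 3] only
    [PI / 2]; hence the bound [4 <= k] in the first part. *)

(** * Zeros of the dispersion function *)

(** The equation [tan (k x) = k tan x] cleared of its denominators; unlike that
    equation, it also makes sense at [PI / 2]. *)
Definition dispersion (k : nat) (x : R) : R :=
  INR k * sin x * cos (INR k * x) - cos x * sin (INR k * x).

(** At a zero of the dispersion with [cos x <> 0], [cos (k x) = 0] would force
    [sin (k x) = 0] as well, so that both tangents are automatically defined. *)
Lemma tan_equation_iff_dispersion k x :
  cos x <> 0 -> (tan_equation k x <-> dispersion k x = 0).
Proof.
  intros Hc; unfold tan_equation, dispersion, tan; split.
  - intros (_ & Hk & E).
    assert (E' : sin (INR k * x) = INR k * (sin x / cos x) * cos (INR k * x)).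
    { rewrite <- E; field; exact Hk. }
    rewrite E'; field; exact Hc.
  - intros E.
    assert (Hk : cos (INR k * x) <> 0).
    { intros Hk; rewrite Hk in E.
      assert (Hs : sin (INR k * x) = 0).
      { apply (Rmult_eq_reg_l (cos x)); [lra | exact Hc]. }
      pose proof (sin2_cos2 (INR k * x)) as H1; unfold Rsqr in H1.
      rewrite Hk, Hs in H1; lra. }
    repeat split; [exact Hc | exact Hk |].
    apply (Rmult_eq_reg_r (cos (INR k * x) * cos x)).
    + field_simplify; [lra | exact Hc | exact Hk].
    + apply Rmult_integral_contrapositive_currified; assumption.
Qed.

Lemma cos_eq_0_in_0_PI x : 0 < x < PI -> cos x = 0 -> x = PI / 2.
Proof.
  intros Hx E.
  destruct (Rtotal_order x (PI / 2)) as [H | [H | H]]; [| exact H |].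
  - pose proof (cos_gt_0 x); lra.
  - pose proof (cos_lt_0 x); lra.
Qed.

Lemma sin_INR_PI j : sin (INR j * PI) = 0.
Proof.
  apply sin_eq_0_1; exists (Z.of_nat j); now rewrite <- INR_IZR_INZ.
Qed.

Lemma sin_neq_0_between j x : INR j * PI < x < INR (S j) * PI -> sin x <> 0.
Proof.
  intros [H1 H2] E; destruct (sin_eq_0_0 x E) as [z ->].
  pose proof PI_RGT_0 as HPI.
  apply Rmult_lt_reg_r in H1; [| exact HPI].
  apply Rmult_lt_reg_r in H2; [| exact HPI].
  rewrite INR_IZR_INZ in H1, H2.
  apply lt_IZR in H1; apply lt_IZR in H2; lia.
Qed.

Lemma is_derive_dispersion k x :
  is_derive (dispersion k) x ((1 - INR k ^ 2) * sin x * sin (INR k * x)).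
Proof. unfold dispersion; auto_derive; [trivial | ring]. Qed.

Lemma dispersion_at_odd_half_PI k : Nat.Odd k -> dispersion k (PI / 2) = 0.
Proof.
  intros [m ->]; unfold dispersion.
  replace (INR (2 * m + 1) * (PI / 2)) with (PI / 2 + INR m * PI).
  - rewrite cos_plus, cos_PI2, sin_INR_PI; ring.
  - rewrite plus_INR, mult_INR; simpl; field.
Qed.

Lemma dispersion_at_even_half_PI k :
  dispersion k (PI / 2) = 0 -> (0 < k)%nat -> Nat.Odd k.
Proof.
  intros E Hk; destruct (Nat.Even_or_Odd k) as [[m ->] | H]; [exfalso | exact H].
  assert (E' : INR (2 * m) * (PI / 2) = INR m * PI)
    by (rewrite mult_INR; simpl; field).
  unfold dispersion in E; rewrite E', cos_PI2, sin_PI2, sin_INR_PI in E.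
  assert (Hc : cos (INR m * PI) = 0).
  { apply (Rmult_eq_reg_l (INR (2 * m))); [lra | apply not_0_INR; lia]. }
  pose proof (sin2_cos2 (INR m * PI)) as H1; unfold Rsqr in H1.
  rewrite Hc, sin_INR_PI in H1; lra.
Qed.

(** Rolle: between two zeros of the dispersion the derivative vanishes, which it
    cannot do inside a cell of the grid. *)
Lemma dispersion_zero_unique k j x y :
  (2 <= k)%nat -> 0 <= x -> y <= PI ->
  INR j * PI <= INR k * x -> INR k * y <= INR (S j) * PI ->
  dispersion k x = 0 -> dispersion k y = 0 -> ~ x < y.
Proof.
  intros Hk Hx0 HyP Hx Hy Ex Ey Hlt.
  destruct (MVT_cor2 (dispersion k)
              (fun c => (1 - INR k ^ 2) * sin c * sin (INR k * c)) x y Hlt)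
    as (c & E & Hc).
  { intros c _; apply is_derive_Reals, is_derive_dispersion. }
  assert (HK : 2 <= INR k) by (replace 2 with (INR 2) by reflexivity; now apply le_INR).
  rewrite Ex, Ey in E.
  assert (Hs : 0 < sin c) by (apply sin_gt_0; lra).
  assert (Hks : sin (INR k * c) <> 0) by (apply (sin_neq_0_between j); split; nra).
  assert (HD : (1 - INR k ^ 2) * sin c * sin (INR k * c) * (y - x) <> 0).
  { repeat apply Rmult_integral_contrapositive_currified; try lra; nra. }
  lra.
Qed.

Lemma dispersion_at_grid k j :
  (0 < k)%nat ->
  dispersion k (INR j * PI / INR k) =
  INR k * sin (INR j * PI / INR k) * cos (INR j * PI).
Proof.
  intros Hk; unfold dispersion.
  replace (INR k * (INR j * PI / INR k)) with (INR j * PI)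
    by (field; apply not_0_INR; lia).
  rewrite sin_INR_PI; ring.
Qed.

Lemma cos_INR_PI_sqr j : cos (INR j * PI) * cos (INR j * PI) = 1.
Proof.
  pose proof (sin2_cos2 (INR j * PI)) as H; unfold Rsqr in H.
  rewrite sin_INR_PI in H; lra.
Qed.

Lemma grid_in_0_PI k j :
  (0 < j < k)%nat -> 0 < INR j * PI / INR k < PI.
Proof.
  intros [Hj Hjk]; pose proof PI_RGT_0 as HPI.
  apply lt_INR in Hj; apply lt_INR in Hjk; simpl in Hj.
  split.
  - apply Rdiv_lt_0_compat; nra.
  - apply Rlt_div_l; nra.
Qed.

Lemma dispersion_at_grid_neq_0 k j :
  (0 < j < k)%nat -> dispersion k (INR j * PI / INR k) <> 0.
Proof.
  intros Hj; rewrite dispersion_at_grid by lia.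
  pose proof (cos_INR_PI_sqr j) as Hc.
  pose proof (grid_in_0_PI k j Hj) as Hg.
  pose proof (sin_gt_0 (INR j * PI / INR k) (proj1 Hg) (proj2 Hg)).
  repeat apply Rmult_integral_contrapositive_currified;
    [apply not_0_INR; lia | lra | nra].
Qed.

(** The value at the grid point [x = j PI / k] is [(-1) ^ j] times the positive number
    [k sin x], so the intermediate value theorem applies in every inner cell. *)
Lemma dispersion_zero_exists k j :
  (0 < j)%nat -> (S j < k)%nat ->
  exists x, INR j * PI / INR k < x < INR (S j) * PI / INR k /\ dispersion k x = 0.
Proof.
  intros Hj Hjk; pose proof PI_RGT_0 as HPI.
  assert (Hk : 0 < INR k) by (apply lt_0_INR; lia).
  set (a := INR j * PI / INR k); set (b := INR (S j) * PI / INR k).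
  assert (Hab : a < b).
  { unfold a, b, Rdiv; rewrite S_INR.
    apply Rmult_lt_compat_r; [now apply Rinv_0_lt_compat | lra]. }
  assert (Ha : dispersion k a <> 0) by (apply dispersion_at_grid_neq_0; lia).
  assert (Hb : dispersion k b <> 0) by (apply dispersion_at_grid_neq_0; lia).
  destruct (IVT_cor (dispersion k) a b) as (z & Hz & E).
  - intros x; apply derivable_continuous_pt.
    eexists; apply is_derive_Reals, is_derive_dispersion.
  - lra.
  - unfold a, b; rewrite !dispersion_at_grid by lia.
    fold a; fold b.
    replace (INR (S j) * PI) with (INR j * PI + PI) by (rewrite S_INR; ring).
    rewrite neg_cos.
    assert (0 < sin a) by (apply sin_gt_0; apply (grid_in_0_PI k j); lia).
    assert (0 < sin b) by (apply sin_gt_0; apply (grid_in_0_PI k (S j)); lia).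
    replace (INR k * sin a * cos (INR j * PI) * (INR k * sin b * - cos (INR j * PI)))
      with (- ((INR k * sin a) * (INR k * sin b)
               * (cos (INR j * PI) * cos (INR j * PI)))) by ring.
    rewrite cos_INR_PI_sqr.
    assert (0 < INR k * sin a) by nra; assert (0 < INR k * sin b) by nra; nra.
  - exists z; split; [| exact E].
    destruct (Req_dec z a) as [-> |]; [contradiction |].
    destruct (Req_dec z b) as [-> |]; [contradiction |]; lra.
Qed.

(** Cells are added one at a time; the grid points between them are not zeros. *)
Lemma dispersion_zeros_below_grid k m :
  (2 <= k)%nat -> (m + 1 < k)%nat ->
  exists l : list R, NoDup l /\ length l = m /\
    forall x, In x l <->
      (INR 1 * PI / INR k < x < INR (S m) * PI / INR k /\ dispersion k x = 0).
Proof.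
  intros Hk; assert (HK : 0 < INR k) by (apply lt_0_INR; lia).
  pose proof PI_RGT_0 as HPI.
  induction m as [| m IH]; intros Hm.
  - exists nil; split; [constructor | split; [reflexivity |]].
    intros x; split; [intros [] | intros [H _]; lra].
  - destruct IH as (l & ND & Hl & Hin); [lia |].
    destruct (dispersion_zero_exists k (S m)) as (z & Hz & Ez); [lia | lia |].
    set (a := INR (S m) * PI / INR k) in *.
    set (b := INR (S (S m)) * PI / INR k) in *.
    assert (Hg : INR 1 * PI / INR k <= a).
    { unfold a, Rdiv; apply Rmult_le_compat_r;
        [left; now apply Rinv_0_lt_compat |].
      apply Rmult_le_compat_r; [lra | apply le_INR; lia]. }
    assert (HbP : 0 < a < PI /\ 0 < b < PI).
    { split; apply grid_in_0_PI; lia. }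
    assert (Ea : INR k * a = INR (S m) * PI) by (unfold a; field; lra).
    assert (Eb : INR k * b = INR (S (S m)) * PI) by (unfold b; field; lra).
    exists (z :: l)%list; split; [| split; [| intros x; split]].
    + constructor; [| exact ND].
      intros Hzl; apply Hin in Hzl; lra.
    + simpl; congruence.
    + intros [<- | H]; [split; [lra | exact Ez] |].
      apply Hin in H; split; [lra | apply H].
    + intros [Hx Ex]; simpl.
      destruct (Rtotal_order x a) as [H | [H | H]].
      * right; apply Hin; lra.
      * exfalso; apply (dispersion_at_grid_neq_0 k (S m)); [lia |].
        fold a; now rewrite <- H.
      * left; destruct (Rtotal_order z x) as [H' | [H' | H']]; [exfalso | exact H' | exfalso].
        -- apply (dispersion_zero_unique k (S m) z x); try assumption; try lra.
           ++ rewrite <- Ea; apply Rmult_le_compat_l; lra.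
           ++ rewrite <- Eb; apply Rmult_le_compat_l; lra.
        -- apply (dispersion_zero_unique k (S m) x z); try assumption; try lra.
           ++ rewrite <- Ea; apply Rmult_le_compat_l; lra.
           ++ rewrite <- Eb; apply Rmult_le_compat_l; lra.
Qed.

(** The end points [0] and [PI] are themselves zeros, so the first and the last
    cell contain no further one; each of the other [k - 2] cells contains one. *)
Lemma dispersion_zeros k :
  (2 <= k)%nat ->
  exists l : list R, NoDup l /\ length l = (k - 2)%nat /\
    forall x, In x l <-> (0 < x < PI /\ dispersion k x = 0).
Proof.
  intros Hk; assert (HK : 0 < INR k) by (apply lt_0_INR; lia).
  pose proof PI_RGT_0 as HPI.
  destruct (dispersion_zeros_below_grid k (k - 2)) as (l & ND & Hl & Hin); [lia | lia |].
  exists l; split; [exact ND |]; split; [exact Hl |].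
  intros x; rewrite Hin.
  replace (S (k - 2)) with (k - 1)%nat by lia.
  set (a := INR 1 * PI / INR k); set (b := INR (k - 1) * PI / INR k).
  assert (Hab : 0 < a < PI /\ 0 < b < PI).
  { split; apply grid_in_0_PI; lia. }
  assert (Ea : INR k * a = INR 1 * PI) by (unfold a; field; lra).
  assert (Eb : INR k * b = INR (k - 1) * PI) by (unfold b; field; lra).
  split; [intros [H1 H2]; split; [lra | exact H2] |].
  intros [Hx Ex]; split; [| exact Ex].
  assert (E0 : dispersion k 0 = 0).
  { unfold dispersion; rewrite Rmult_0_r, sin_0; ring. }
  assert (EP : dispersion k PI = 0).
  { unfold dispersion; rewrite sin_PI, sin_INR_PI; ring. }
  split; apply Rnot_le_lt; intros H.
  - apply (dispersion_zero_unique k 0 0 x); try assumption; try lra.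
    + simpl; lra.
    + rewrite <- Ea; apply Rmult_le_compat_l; lra.
  - apply (dispersion_zero_unique k (k - 1) x PI); try assumption; try lra.
    + rewrite <- Eb; apply Rmult_le_compat_l; lra.
    + replace (S (k - 1)) with k by lia; lra.
Qed.

(** The zero count replaces an explicit discussion of the polynomial equations in
    [cos x] for these two values of [k]. *)
Lemma dispersion_zero_small k x :
  (2 <= k < 4)%nat -> 0 < x < PI -> dispersion k x = 0 -> x = PI / 2.
Proof.
  intros Hk Hx E; pose proof PI_RGT_0 as HPI.
  destruct (dispersion_zeros k) as (l & ND & Hl & Hin); [lia |].
  assert (Hxl : In x l) by (apply Hin; auto).
  destruct l as [| y [| y' l]]; simpl in Hl.
  - contradiction.
  (* One zero, hence [k = 3]; and [PI / 2] is a zero because 3 is odd. *)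
  - assert (H3 : In (PI / 2) (y :: nil)).
    { apply Hin; split; [lra |]; apply dispersion_at_odd_half_PI; exists 1%nat; lia. }
    destruct Hxl as [<- | []]; destruct H3 as [H3 | []]; exact H3.
  - lia.
Qed.

Lemma tan_equation_or_half_PI_iff k x :
  (2 <= k)%nat -> 0 < x < PI ->
  (tan_equation k x \/ (Nat.Odd k /\ x = PI / 2) <-> dispersion k x = 0).
Proof.
  intros Hk Hx; destruct (Req_dec (cos x) 0) as [Hc | Hc].
  - pose proof (cos_eq_0_in_0_PI x Hx Hc) as ->; split.
    + intros [(H & _) | [H _]]; [contradiction | now apply dispersion_at_odd_half_PI].
    + intros E; right; split; [apply dispersion_at_even_half_PI; [exact E | lia] | reflexivity].
  - rewrite <- (tan_equation_iff_dispersion k x Hc); split; [| now left].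
    intros [H | [_ ->]]; [exact H | now rewrite cos_PI2 in Hc].
Qed.
(** * Fourier coefficients of periodic functions *)

Definition periodic (u : R -> R) : Prop := forall t, u (t + PI) = u t.

(** The [n]-th harmonic of [u], tested against every phase: [phi = 0] gives the
    cosine coefficient and [phi = - PI / 2] the sine coefficient.  Keeping the
    phase free turns a translation of [u] into a shift of [phi]. *)
Definition harmonic (u : R -> R) (n : nat) (phi : R) : R :=
  RInt (fun t => u t * cos (2 * INR n * t + phi)) 0 PI.

(** [ring] and [field] need an equation typed in [R] itself, not in a normed module
    whose carrier merely reduces to [R]. *)
Ltac eq_in_R := match goal with |- ?x = ?y => change (@eq R x y) end.

Lemma continuous_wave a b t : continuous (fun s : R => cos (a * s + b)) t.
Proof. apply (ex_derive_continuous (V := R_NormedModule)); auto_derive; trivial. Qed.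

Lemma continuous_mult_wave (u : R -> R) a b :
  (forall t, continuous u t) ->
  forall t, continuous (fun s => u s * cos (a * s + b)) t.
Proof.
  intros Hu t; apply (continuous_mult (K := R_AbsRing)); [apply Hu | apply continuous_wave].
Qed.

Lemma continuous_translate (u : R -> R) s :
  (forall t, continuous u t) -> forall t, continuous (fun x => u (x + s)) t.
Proof.
  intros Hu t; apply (continuous_comp (fun x : R => x + s) u); [| apply Hu].
  apply (ex_derive_continuous (V := R_NormedModule)); auto_derive; trivial.
Qed.

Lemma continuous_lin (u v : R -> R) a b :
  (forall t, continuous u t) -> (forall t, continuous v t) ->
  forall t, continuous (fun s => a * u s + b * v s) t.
Proof.
  intros Hu Hv t.
  apply (continuous_plus (V := R_NormedModule));
    apply (continuous_scal_r (V := R_NormedModule)); auto.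
Qed.

Lemma ex_RInt_cont (u : R -> R) a b : (forall t, continuous u t) -> ex_RInt u a b.
Proof. intros Hu; apply (ex_RInt_continuous (V := R_CompleteNormedModule)); auto. Qed.

Lemma RInt_lin (u v : R -> R) p q a b :
  (forall t, continuous u t) -> (forall t, continuous v t) ->
  RInt (fun t => p * u t + q * v t) a b = p * RInt u a b + q * RInt v a b.
Proof.
  intros Hu Hv; apply is_RInt_unique.
  apply (is_RInt_plus (V := R_NormedModule));
    apply (is_RInt_scal (V := R_NormedModule));
    apply (RInt_correct (V := R_CompleteNormedModule)); now apply ex_RInt_cont.
Qed.

Lemma RInt_derive_real (F f : R -> R) a b :
  (forall t, is_derive F t (f t)) -> (forall t, continuous f t) ->
  RInt f a b = F b - F a.
Proof.
  intros HF Hf; apply is_RInt_unique.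
  apply (is_RInt_derive (V := R_CompleteNormedModule)); auto.
Qed.

Lemma RInt_translate (u : R -> R) s a b :
  (forall t, continuous u t) ->
  RInt (fun t => u (t + s)) a b = RInt u (a + s) (b + s).
Proof.
  intros Hu.
  pose proof (RInt_comp_lin (V := R_CompleteNormedModule) u 1 s a b) as H.
  rewrite !Rmult_1_l in H; rewrite <- H by now apply ex_RInt_cont.
  apply RInt_ext; intros x _; change scal with Rmult; simpl.
  change (u (x + s) = 1 * u (1 * x + s)); now rewrite !Rmult_1_l.
Qed.

Lemma RInt_periodic (u : R -> R) s :
  (forall t, continuous u t) -> periodic u ->
  RInt (fun t => u (t + s)) 0 PI = RInt u 0 PI.
Proof.
  intros Hu Hp; rewrite RInt_translate by exact Hu.
  assert (E1 : RInt u (0 + s) (PI + s) + RInt u (PI + s) PI = RInt u (0 + s) PI)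
    by (apply (RInt_Chasles (V := R_CompleteNormedModule)); now apply ex_RInt_cont).
  assert (E2 : RInt u (0 + s) 0 + RInt u 0 PI = RInt u (0 + s) PI)
    by (apply (RInt_Chasles (V := R_CompleteNormedModule)); now apply ex_RInt_cont).
  assert (E3 : RInt (fun t => u (t + PI)) s 0 = RInt u (s + PI) (0 + PI))
    by now apply RInt_translate.
  rewrite (RInt_ext _ u) in E3 by (intros; apply Hp).
  rewrite Rplus_0_l in E1, E2, E3 |- *; rewrite (Rplus_comm s PI) in E3.
  lra.
Qed.

Lemma periodic_mult_wave (u : R -> R) n phi :
  periodic u -> periodic (fun t => u t * cos (2 * INR n * t + phi)).
Proof.
  intros Hp t; rewrite Hp; f_equal.
  rewrite <- (cos_period (2 * INR n * t + phi) n); f_equal; ring.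
Qed.

Lemma harmonic_ext (u v : R -> R) n phi :
  (forall t, u t = v t) -> harmonic u n phi = harmonic v n phi.
Proof. intros H; apply RInt_ext; intros t _; now rewrite H. Qed.

Lemma harmonic_lin (u v : R -> R) a b n phi :
  (forall t, continuous u t) -> (forall t, continuous v t) ->
  harmonic (fun t => a * u t + b * v t) n phi =
  a * harmonic u n phi + b * harmonic v n phi.
Proof.
  intros Hu Hv; unfold harmonic.
  rewrite <- RInt_lin by now apply continuous_mult_wave.
  apply RInt_ext; intros t _; eq_in_R; ring.
Qed.

(** Phases enter linearly through the addition formulas for the cosine. *)
Lemma harmonic_phase (u : R -> R) n phi a b psi chi :
  (forall t, continuous u t) ->
  (forall x, cos (x + phi) = a * cos (x + psi) + b * cos (x + chi)) ->
  harmonic u n phi = a * harmonic u n psi + b * harmonic u n chi.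
Proof.
  intros Hu E; unfold harmonic.
  rewrite <- RInt_lin by now apply continuous_mult_wave.
  apply RInt_ext; intros t _; rewrite E; eq_in_R; ring.
Qed.

Lemma harmonic_translate (u : R -> R) s n phi :
  (forall t, continuous u t) -> periodic u ->
  harmonic (fun t => u (t + s)) n phi = harmonic u n (phi - 2 * INR n * s).
Proof.
  intros Hu Hp; unfold harmonic at 2.
  rewrite <- (RInt_periodic _ s)
    by first [now apply continuous_mult_wave | now apply periodic_mult_wave].
  apply RInt_ext; intros t _; do 2 f_equal; ring.
Qed.

(** Integration by parts; the boundary terms cancel by periodicity, and the resulting
    sine is a cosine of phase shifted by [- PI / 2]. *)
Lemma harmonic_derive (u du : R -> R) n phi :
  (forall t, is_derive u t (du t)) -> (forall t, continuous du t) -> periodic u ->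
  harmonic du n phi = 2 * INR n * harmonic u n (phi - PI / 2).
Proof.
  intros Hu Hdu Hp.
  assert (Hc : forall t, continuous u t).
  { intros t; apply (ex_derive_continuous (V := R_NormedModule)); eexists; apply Hu. }
  assert (E : RInt (fun t => 1 * (du t * cos (2 * INR n * t + phi))
                   + - (2 * INR n) * (u t * cos (2 * INR n * t + (phi - PI / 2)))) 0 PI
              = u PI * cos (2 * INR n * PI + phi) - u 0 * cos (2 * INR n * 0 + phi)).
  { apply (RInt_derive_real (fun t => u t * cos (2 * INR n * t + phi))).
    - intros t.
      replace (2 * INR n * t + (phi - PI / 2)) with (- (PI / 2 - (2 * INR n * t + phi)))
        by ring.
      rewrite cos_neg, cos_shift.
      evar_last.
      + apply (is_derive_mult u (fun s => cos (2 * INR n * s + phi)) t (du t)).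
        * apply Hu.
        * auto_derive; [trivial | reflexivity].
        * intros; apply Rmult_comm.
      + unfold plus, mult; simpl; ring.
    - apply continuous_lin; now apply continuous_mult_wave. }
  rewrite RInt_lin in E by now apply continuous_mult_wave.
  assert (E0 : u PI = u 0) by (rewrite <- (Hp 0); f_equal; ring).
  rewrite E0, Rmult_0_r, Rplus_0_l, (Rplus_comm (2 * INR n * PI)), cos_period in E.
  unfold harmonic; lra.
Qed.

Lemma RInt_wave n phi :
  RInt (fun t => cos (2 * INR (S n) * t + phi)) 0 PI = 0.
Proof.
  assert (Hn : INR (S n) <> 0) by (apply not_0_INR; lia).
  rewrite (RInt_derive_real (fun t => sin (2 * INR (S n) * t + phi) / (2 * INR (S n)))).
  - rewrite Rmult_0_r, (Rplus_comm _ phi), sin_period, Rplus_0_l; eq_in_R; ring.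
  - intros t; generalize dependent (INR (S n)); intros w Hw.
    auto_derive; [trivial | field; exact Hw].
  - apply continuous_wave.
Qed.

Lemma RInt_const_real c : RInt (fun _ => c) 0 PI = PI * c.
Proof.
  rewrite (RInt_const (V := R_CompleteNormedModule)).
  change ((PI - 0) * c = PI * c); ring.
Qed.

Lemma harmonic_const c n phi : harmonic (fun _ => c) (S n) phi = 0.
Proof.
  unfold harmonic.
  rewrite (RInt_ext _ (fun t => c * cos (2 * INR (S n) * t + phi)
                               + 0 * cos (2 * INR (S n) * t + phi)))
    by (intros; eq_in_R; ring).
  rewrite RInt_lin by apply continuous_wave.
  rewrite RInt_wave; ring.
Qed.

Lemma harmonic_0_const c phi : harmonic (fun _ => c) 0 phi = PI * (c * cos phi).
Proof.
  unfold harmonic; rewrite <- RInt_const_real.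
  apply RInt_ext; intros t _; simpl; do 2 f_equal; ring.
Qed.

Lemma harmonic_0 (u : R -> R) phi :
  (forall t, continuous u t) -> harmonic u 0 phi = cos phi * harmonic u 0 0.
Proof.
  intros Hu; unfold harmonic.
  rewrite (RInt_ext _ (fun t => cos phi * (u t * cos (2 * INR 0 * t + 0))
                               + 0 * (u t * cos (2 * INR 0 * t + 0)))).
  2:{ intros t _; simpl; rewrite Rmult_0_r, Rmult_0_l, !Rplus_0_l, cos_0; eq_in_R; ring. }
  rewrite RInt_lin by now apply continuous_mult_wave.
  ring.
Qed.

(** Multiplication by [cos t ^ 2] only mixes neighbouring harmonics, so functions
    without harmonics remain so; iterating it produces the weights used below. *)
Lemma harmonic_mult_cos_sqr (u : R -> R) :
  (forall t, continuous u t) ->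
  (forall n phi, harmonic u n phi = 0) ->
  forall n phi, harmonic (fun t => u t * (cos t * cos t)) n phi = 0.
Proof.
  intros Hu H0.
  assert (Hlin : forall n phi m1 phi1 m2 phi2,
    (forall t, cos t * cos t * cos (2 * INR n * t + phi) =
       1 / 2 * cos (2 * INR n * t + phi)
       + 1 / 4 * (cos (2 * INR m1 * t + phi1) + cos (2 * INR m2 * t + phi2))) ->
    harmonic (fun t => u t * (cos t * cos t)) n phi = 0).
  { intros n phi m1 phi1 m2 phi2 E; unfold harmonic.
    rewrite (RInt_ext _ (fun t => 1 * (1 / 2 * (u t * cos (2 * INR n * t + phi))
                 + 1 / 4 * (u t * cos (2 * INR m1 * t + phi1)))
             + 1 / 4 * (u t * cos (2 * INR m2 * t + phi2)))).
    2:{ intros t _; rewrite Rmult_assoc, E; eq_in_R; ring. }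
    rewrite RInt_lin; [| apply continuous_lin; now apply continuous_mult_wave
                       | now apply continuous_mult_wave].
    rewrite RInt_lin by now apply continuous_mult_wave.
    fold (harmonic u n phi) (harmonic u m1 phi1) (harmonic u m2 phi2).
    rewrite !H0; ring. }
  assert (Hprod : forall t x, cos t * cos t * cos x =
            1 / 2 * cos x + 1 / 4 * (cos (x + 2 * t) + cos (x - 2 * t))).
  { intros t x; rewrite cos_plus, cos_minus, (cos_2a_cos t); field. }
  intros [| n] phi.
  (* The harmonic of index -1 is the first one with the opposite phase. *)
  - apply (Hlin 0%nat phi 1%nat phi 1%nat (- phi)); intros t; rewrite Hprod; do 3 f_equal.
    + f_equal; simpl; ring.
    + rewrite <- (cos_neg (2 * INR 0 * t + phi - 2 * t)); f_equal; simpl; ring.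
  - apply (Hlin (S n) phi (S (S n)) phi n phi); intros t; rewrite Hprod; do 3 f_equal;
      rewrite !S_INR; f_equal; ring.
Qed.

(** * Completeness of the trigonometric system *)

(** The nonnegative [PI]-periodic weight that concentrates at [0] as [m] grows. *)
Definition weight (m : nat) (t : R) : R := (cos t * cos t) ^ m.

Definition wallis (m : nat) : R := RInt (weight m) 0 PI.

Lemma continuous_weight m t : continuous (weight m) t.
Proof.
  apply (ex_derive_continuous (V := R_NormedModule)); unfold weight; auto_derive; trivial.
Qed.

Lemma weight_nonneg m t : 0 <= weight m t.
Proof. apply pow_le; nra. Qed.

(** The primitive [sin t cos t ^ (2 m + 1)] vanishes at both ends of the period. *)
Lemma wallis_succ m : (2 * INR m + 2) * wallis (S m) = (2 * INR m + 1) * wallis m.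
Proof.
  assert (HF : forall t, is_derive (fun t => sin t * cos t * weight m t) t
    ((2 * INR m + 2) * weight (S m) t + - (2 * INR m + 1) * weight m t)).
  { clear; induction m as [| m IH]; intros t;
      pose proof (sin2_cos2 t) as H1; unfold Rsqr in H1.
    - apply (is_derive_ext (fun t => sin t * cos t));
        [intros; unfold weight; simpl; eq_in_R; ring |].
      unfold weight; simpl; auto_derive; [trivial |].
      replace (sin t * (1 * - sin t)) with (- (sin t * sin t)) by ring.
      replace (sin t * sin t) with (1 - cos t * cos t) by lra; ring.
    - apply (is_derive_ext (fun t => (sin t * cos t * weight m t) * (cos t * cos t)));
        [intros; unfold weight; simpl; eq_in_R; ring |].
      evar_last.
      + apply (is_derive_mult _ (fun t => cos t * cos t)); [apply IH | | intros; apply Rmult_comm].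
        auto_derive; [trivial | reflexivity].
      + rewrite S_INR; unfold plus, mult, weight; simpl.
        set (w := (cos t * cos t) ^ m).
        match goal with |- ?l = ?r => replace l with
          (((2 * INR m + 2) * (cos t * cos t) - (2 * INR m + 1) - 2 * (sin t * sin t))
           * (cos t * cos t) * w) by ring end.
        replace (sin t * sin t) with (1 - cos t * cos t) by lra; ring. }
  pose proof (RInt_derive_real _ _ 0 PI HF) as E.
  rewrite RInt_lin in E by apply continuous_weight.
  fold (wallis (S m)) (wallis m) in E; rewrite sin_0, sin_PI in E.
  assert (forall t, continuous (fun t => (2 * INR m + 2) * weight (S m) t
                                   + - (2 * INR m + 1) * weight m t) t) as Hc
    by (apply continuous_lin; apply continuous_weight).
  specialize (E Hc); lra.
Qed.

Lemma wallis_pos m : 0 < wallis m.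
Proof.
  induction m as [| m IH].
  - unfold wallis, weight; simpl; rewrite RInt_const_real; pose proof PI_RGT_0; lra.
  - pose proof (wallis_succ m); pose proof (pos_INR m).
    apply (Rmult_lt_reg_l (2 * INR m + 2)); nra.
Qed.

Lemma RInt_mult_weight_eq_0 (v : R -> R) m :
  (forall t, continuous v t) -> (forall n phi, harmonic v n phi = 0) ->
  RInt (fun t => v t * weight m t) 0 PI = 0.
Proof.
  intros Hv H0.
  assert (H : (forall t, continuous (fun t => v t * weight m t) t) /\
              forall n phi, harmonic (fun t => v t * weight m t) n phi = 0).
  { induction m as [| m [IHc IH]].
    - split.
      + intros t; apply (continuous_mult (K := R_AbsRing)); [apply Hv | apply continuous_weight].
      + intros n phi; rewrite <- (H0 n phi); apply harmonic_ext.
        intros t; unfold weight; simpl; ring.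
    - split.
      + intros t; apply (continuous_mult (K := R_AbsRing)); [apply Hv | apply continuous_weight].
      + intros n phi; rewrite <- (harmonic_mult_cos_sqr _ IHc IH n phi).
        apply harmonic_ext; intros t; unfold weight; simpl; ring. }
  destruct H as [_ H].
  transitivity (harmonic (fun t => v t * weight m t) 0 0); [unfold harmonic | apply H].
  apply RInt_ext; intros t _; simpl.
  replace (2 * 0 * t + 0) with 0 by ring; rewrite cos_0; eq_in_R; ring.
Qed.

(** A lower bound that survives integration against the weights, since
    [sin t ^ 2] is small where they concentrate. *)
Lemma lower_bound_sin_sqr (v : R -> R) :
  (forall t, continuous v t) -> periodic v -> 0 < v 0 ->
  exists C, forall t, 0 <= t <= PI -> v 0 / 2 - C * (sin t * sin t) <= v t.
Proof.
  intros Hv Hp H0; pose proof PI_RGT_0 as HPI.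
  destruct (bounded_continuity (K := R_AbsRing) (V := R_NormedModule) v 0 PI)
    as [M HM]; [intros; apply Hv |].
  assert (Hl : exists d, 0 < d /\ d <= PI / 2 /\ forall t, Rabs t < d -> v 0 / 2 <= v t).
  { assert (Hh : 0 < v 0 / 2) by lra.
    destruct (proj1 (filterlim_locally v (v 0)) (Hv 0) (mkposreal _ Hh)) as [d Hd].
    exists (Rmin d (PI / 2)).
    pose proof (cond_pos d); pose proof (Rmin_l d (PI / 2)); pose proof (Rmin_r d (PI / 2)).
    split; [apply Rmin_pos; lra | split; [lra |]].
    intros t Ht; assert (B : ball (M := R_UniformSpace) 0 d t).
    { change (Rabs (t - 0) < d); rewrite Rminus_0_r; lra. }
    apply Hd in B; change (Rabs (v t - v 0) < v 0 / 2) in B.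
    apply Rabs_def2 in B; lra. }
  destruct Hl as (d & Hd0 & Hd & Hl).
  assert (Hs : 0 < sin d) by (apply sin_gt_0; lra).
  assert (HM0 : 0 < M).
  { apply Rle_lt_trans with (2 := HM 0 ltac:(lra)); apply norm_ge_0. }
  exists ((M + v 0) / (sin d * sin d)); intros t Ht.
  assert (HC : 0 < (M + v 0) / (sin d * sin d)) by (apply Rdiv_lt_0_compat; nra).
  assert (Hss : 0 <= sin t * sin t) by nra.
  destruct (Rlt_dec t d) as [H1 | H1].
  { pose proof (Hl t); rewrite Rabs_pos_eq in H by lra; nra. }
  destruct (Rlt_dec (PI - t) d) as [H2 | H2].
  { assert (v 0 / 2 <= v (t - PI)) by (apply Hl; rewrite Rabs_minus_sym, Rabs_pos_eq; lra).
    assert (E : v t = v (t - PI)) by (rewrite <- (Hp (t - PI)); f_equal; ring).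
    rewrite E; nra. }
  assert (Hst : sin d <= sin t).
  { destruct (Rle_dec t (PI / 2)).
    - apply sin_incr_1; lra.
    - rewrite <- (sin_PI_x t); apply sin_incr_1; lra. }
  assert (Hsq : M + v 0 <= (M + v 0) / (sin d * sin d) * (sin t * sin t)).
  { replace (M + v 0) with ((M + v 0) / (sin d * sin d) * (sin d * sin d)) at 1
      by (field; lra).
    apply Rmult_le_compat_l; nra. }
  pose proof (HM t Ht) as Hb; change (Rabs (v t) < M) in Hb.
  apply Rabs_def2 in Hb; lra.
Qed.

(** Integrated against the weights, the lower bound yields
    [v 0 / 2 * W m <= C * (W m - W (m + 1))] for the Wallis integrals [W].  By their
    recurrence the right-hand side is [C * W m / (2 m + 2)], which is too small for
    large [m]. *)
Lemma harmonics_0_not_pos (v : R -> R) :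
  (forall t, continuous v t) -> periodic v -> (forall n phi, harmonic v n phi = 0) ->
  ~ 0 < v 0.
Proof.
  intros Hv Hp H0 Hpos.
  destruct (lower_bound_sin_sqr v Hv Hp Hpos) as [C HC].
  assert (Hm : forall m, v 0 * (INR m + 1) <= C).
  { intros m.
    assert (Hle : RInt (fun t => (v 0 / 2 - C) * weight m t + C * weight (S m) t) 0 PI
                  <= RInt (fun t => v t * weight m t) 0 PI).
    { apply RInt_le.
      - pose proof PI_RGT_0; lra.
      - apply ex_RInt_cont, continuous_lin; apply continuous_weight.
      - apply ex_RInt_cont; intros t.
        apply (continuous_mult (K := R_AbsRing)); [apply Hv | apply continuous_weight].
      - intros t Ht; change (weight (S m) t) with (cos t * cos t * weight m t).
        pose proof (sin2_cos2 t) as H1; unfold Rsqr in H1.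
        replace ((v 0 / 2 - C) * weight m t + C * (cos t * cos t * weight m t))
          with ((v 0 / 2 - C * (1 - cos t * cos t)) * weight m t) by ring.
        apply Rmult_le_compat_r; [apply weight_nonneg |].
        replace (1 - cos t * cos t) with (sin t * sin t) by lra.
        apply HC; lra. }
    rewrite RInt_mult_weight_eq_0, RInt_lin in Hle by (assumption || apply continuous_weight).
    fold (wallis m) (wallis (S m)) in Hle.
    pose proof (wallis_succ m) as HW; pose proof (wallis_pos m); pose proof (pos_INR m).
    apply (Rmult_le_compat_l (2 * INR m + 2)) in Hle; [| lra].
    replace ((2 * INR m + 2) * ((v 0 / 2 - C) * wallis m + C * wallis (S m)))
      with ((2 * INR m + 2) * ((v 0 / 2 - C) * wallis m)
            + C * ((2 * INR m + 2) * wallis (S m))) in Hle by ring.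
    rewrite HW in Hle.
    apply (Rmult_le_reg_r (wallis m)); [assumption | lra]. }
  destruct (INR_unbounded (C / v 0)) as [m Hm'].
  specialize (Hm m); apply Rlt_div_l in Hm'; [nra | exact Hpos].
Qed.

Lemma harmonics_0_eq_0 (u : R -> R) :
  (forall t, continuous u t) -> periodic u -> (forall n phi, harmonic u n phi = 0) ->
  forall t, u t = 0.
Proof.
  intros Hu Hp H0 s.
  assert (Hsign : forall a, ~ 0 < a * u s).
  { intros a Ha; set (v := fun t => a * u (t + s) + 0 * u (t + s)).
    apply (harmonics_0_not_pos v).
    - apply continuous_lin; now apply continuous_translate.
    - intros t; unfold v; replace (t + PI + s) with (t + s + PI) by ring; now rewrite Hp.
    - intros n phi; unfold v.
      rewrite harmonic_lin, harmonic_translate, H0 by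
        (assumption || now apply continuous_translate); ring.
    - unfold v; rewrite Rplus_0_l; lra. }
  pose proof (Hsign 1); pose proof (Hsign (-1)); lra.
Qed.

(** Only the harmonics 0 and 1 survive; they are those of the explicit
    trigonometric polynomial, with which [u] therefore agrees. *)
Lemma low_harmonics (u : R -> R) :
  (forall t, continuous u t) -> periodic u ->
  (forall n phi, (2 <= n)%nat -> harmonic u n phi = 0) ->
  exists A p q, forall t, u t = A + p * cos (2 * t) + q * sin (2 * t).
Proof.
  intros Hu Hp H2; pose proof PI_RGT_0 as HPI.
  set (a := harmonic u 1 0); set (b := harmonic u 1 (- (PI / 2))).
  set (wave := fun phi t => cos (2 * t + phi)).
  assert (Hw : forall phi t, continuous (wave phi) t) by (intros; apply continuous_wave).
  set (A := harmonic u 0 0 / PI).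
  assert (Hc : forall t, continuous (fun _ : R => 1) t) by (intros; apply continuous_const).
  set (r := fun t => 1 * (1 * u t + - A * 1)
                     + - (2 / PI) * (a * wave 0 t + b * wave (- (PI / 2)) t)).
  assert (Hcu : forall t, continuous (fun t => 1 * u t + - A * 1) t)
    by (apply (continuous_lin u (fun _ => 1)); assumption).
  assert (Hcw : forall t, continuous (fun t => a * wave 0 t + b * wave (- (PI / 2)) t) t)
    by (apply continuous_lin; apply Hw).
  assert (Hwave : forall psi n phi, n <> 1%nat -> harmonic (wave psi) n phi = 0).
  { intros psi n phi Hn; unfold harmonic, wave.
    destruct n as [| [| n]]; [| contradiction |].
    - rewrite (RInt_ext _ (fun t => cos phi * cos (2 * INR 1 * t + psi)
                                    + 0 * cos (2 * INR 1 * t + psi))).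
      2:{ intros t _; simpl; rewrite Rmult_0_r, Rmult_0_l, Rplus_0_l, Rmult_1_r; eq_in_R; ring. }
      rewrite RInt_lin by apply continuous_wave; rewrite RInt_wave; ring.
    - rewrite (RInt_ext _ (fun t =>
        1 / 2 * cos (2 * INR (S (S (S n))) * t + (phi + psi))
        + 1 / 2 * cos (2 * INR (S n) * t + (phi - psi)))).
      2:{ intros t _; rewrite !S_INR; set (x := 2 * t + psi).
          set (y := 2 * (INR n + 1 + 1) * t + phi).
          replace (2 * (INR n + 1 + 1 + 1) * t + (phi + psi)) with (y + x)
            by (unfold x, y; ring).
          replace (2 * (INR n + 1) * t + (phi - psi)) with (y - x) by (unfold x, y; ring).
          rewrite cos_plus, cos_minus; eq_in_R; field. }
      rewrite RInt_lin by apply continuous_wave; rewrite !RInt_wave; ring. }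
  assert (Hwave1 : forall psi phi, harmonic (wave psi) 1 phi = PI / 2 * cos (phi - psi)).
  { intros psi phi; unfold harmonic, wave.
    rewrite (RInt_ext _ (fun t => 1 / 2 * cos (2 * INR 2 * t + (phi + psi))
                                  + 1 / 2 * cos (2 * INR 0 * t + (phi - psi)))).
    2:{ intros t _; set (x := 2 * t + psi); simpl INR.
        replace (2 * 1 * t + phi) with (2 * t + phi) by ring; set (y := 2 * t + phi).
        replace (2 * (1 + 1) * t + (phi + psi)) with (y + x) by (unfold x, y; ring).
        replace (2 * 0 * t + (phi - psi)) with (y - x) by (unfold x, y; ring).
        rewrite cos_plus, cos_minus; eq_in_R; field. }
    rewrite RInt_lin by apply continuous_wave; rewrite RInt_wave.
    rewrite (RInt_ext (fun t => cos (2 * INR 0 * t + (phi - psi))) (fun _ => cos (phi - psi))).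
    2:{ intros t _; simpl; eq_in_R; f_equal; ring. }
    rewrite RInt_const_real; field. }
  assert (Hr : forall t, r t = 0).
  { apply harmonics_0_eq_0.
    - apply continuous_lin; assumption.
    - intros t; unfold r, wave; rewrite Hp.
      replace (2 * (t + PI) + 0) with (2 * t + 0 + 2 * INR 1 * PI) by (simpl; ring).
      replace (2 * (t + PI) + - (PI / 2)) with (2 * t + - (PI / 2) + 2 * INR 1 * PI)
        by (simpl; ring).
      now rewrite !cos_period.
    - intros n phi; unfold r.
      rewrite harmonic_lin by assumption.
      rewrite (harmonic_lin u (fun _ => 1)), harmonic_lin by (assumption || apply Hw).
      destruct n as [| [| n]].
      + rewrite !Hwave by lia; rewrite harmonic_0_const.
        rewrite (harmonic_0 u phi) by exact Hu; unfold A; field; lra.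
      + rewrite !Hwave1, harmonic_const.
        rewrite (harmonic_phase u 1 phi (cos phi) (- sin phi) 0 (- (PI / 2))); [| exact Hu |].
        2:{ intros x; replace (x + - (PI / 2)) with (- (PI / 2 - x)) by ring.
            rewrite cos_neg, cos_shift, Rplus_0_r, cos_plus; ring. }
        fold a b; replace (phi - - (PI / 2)) with (PI / 2 + phi) by ring.
        rewrite <- (cos_neg (PI/2 + phi)), Rminus_0_r.
        replace (- (PI / 2 + phi)) with (- phi - PI / 2) by ring.
        rewrite cos_minus, cos_PI2, sin_PI2, sin_neg; field; lra.
      + rewrite !Hwave, harmonic_const, H2 by lia; ring. }
  exists A, (2 / PI * a), (2 / PI * b); intros t.
  specialize (Hr t); unfold r, wave in Hr.
  replace (2 * t + - (PI / 2)) with (- (PI / 2 - 2 * t)) in Hr by ring.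
  rewrite cos_neg, cos_shift, Rplus_0_r in Hr; lra.
Qed.

(** * The linearized equation *)

(** A translation by [alpha] acts on the [n]-th harmonic as the phase shift
    [- 2 n alpha].  Read at a phase symmetric about this shift, the two sums below
    become [2 cos (n alpha)] and [2 sin (n alpha)] times one and the same
    coefficient. *)
Lemma linearized_harmonics (h dh : R -> R) alpha C n psi :
  (forall t, is_derive h t (dh t)) -> (forall t, continuous dh t) ->
  periodic h -> periodic dh -> (1 <= n)%nat ->
  (forall t, - (1 / 2) * sin alpha * (dh t + dh (t + alpha))
             + cos alpha * (h (t + alpha) - h t) = C) ->
  dispersion n alpha * harmonic h n psi = 0.
Proof.
  intros Hh Hdh Hp Hdp Hn E.
  assert (Hc : forall t, continuous h t).
  { intros t; apply (ex_derive_continuous (V := R_NormedModule)); eexists; apply Hh. }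
  assert (Hct : forall t, continuous (fun t => h (t + alpha)) t)
    by now apply continuous_translate.
  assert (Hdt : forall t, continuous (fun t => dh (t + alpha)) t)
    by now apply continuous_translate.
  set (beta := INR n * alpha); set (phi := psi + PI / 2 + beta).
  assert (EX : harmonic (fun t =>
       - (1 / 2) * sin alpha * (1 * dh t + 1 * dh (t + alpha))
       + cos alpha * (1 * h (t + alpha) + -1 * h t)) n phi = 0).
  { destruct n as [| n]; [lia |].
    rewrite <- (harmonic_const C n phi); apply harmonic_ext; intros t.
    rewrite <- (E t); ring. }
  rewrite harmonic_lin in EX; [| now apply continuous_lin | now apply continuous_lin].
  rewrite (harmonic_lin dh), (harmonic_lin (fun t => h (t + alpha))) in EX by assumption.
  rewrite !harmonic_translate in EX by assumption.
  rewrite (harmonic_derive h dh n phi), (harmonic_derive h dh n (phi - _)) in EX by assumption.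
  replace (phi - 2 * INR n * alpha - PI / 2) with (psi - beta) in EX
    by (unfold phi, beta; ring).
  replace (phi - PI / 2) with (psi + beta) in EX by (unfold phi, beta; ring).
  replace (phi - 2 * INR n * alpha) with (psi + PI / 2 - beta) in EX
    by (unfold phi, beta; ring).
  rewrite (harmonic_phase h n (psi + beta) (2 * cos beta) (-1) psi (psi - beta)) in EX;
    [| exact Hc |].
  2:{ intros x; replace (x + (psi + beta)) with (x + psi + beta) by ring.
      replace (x + (psi - beta)) with (x + psi - beta) by ring.
      rewrite cos_plus, cos_minus; ring. }
  rewrite (harmonic_phase h n (psi + PI / 2 - beta) (2 * sin beta) 1 psi phi) in EX;
    [| exact Hc |].
  2:{ intros x; unfold phi.
      replace (x + (psi + PI / 2 - beta)) with (PI / 2 + (x + psi - beta)) by ring.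
      replace (x + (psi + PI / 2 + beta)) with (PI / 2 + (x + psi + beta)) by ring.
      rewrite !(cos_plus (PI / 2)), cos_PI2, sin_PI2, sin_plus, sin_minus; ring. }
  unfold dispersion; fold beta.
  apply (Rmult_eq_reg_l (-2)); [| lra].
  rewrite Rmult_0_r, <- EX; field.
Qed.

Lemma linearized_solution (h dh : R -> R) alpha C :
  (forall t, is_derive h t (dh t)) -> (forall t, continuous dh t) ->
  periodic h -> periodic dh ->
  (forall t, - (1 / 2) * sin alpha * (dh t + dh (t + alpha))
             + cos alpha * (h (t + alpha) - h t) = C) ->
  (forall n, (2 <= n)%nat -> dispersion n alpha <> 0) ->
  exists A p q, forall t, h t = A + p * cos (2 * t) + q * sin (2 * t).
Proof.
  intros Hh Hdh Hp Hdp E HD; apply low_harmonics; [| exact Hp |].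
  - intros t; apply (ex_derive_continuous (V := R_NormedModule)); eexists; apply Hh.
  - intros n phi Hn.
    apply (Rmult_eq_reg_l (dispersion n alpha)); [| now apply HD].
    rewrite Rmult_0_r; apply (linearized_harmonics h dh alpha C); try assumption; lia.
Qed.

(** * First-order comparison *)

Lemma eq_mod_eps2_sym F G : eq_mod_eps2 F G -> eq_mod_eps2 G F.
Proof.
  intros [M H]; exists M; apply filter_imp with (2 := H).
  intros e He; now rewrite Rabs_minus_sym.
Qed.

Lemma eq_mod_eps2_lin F G F' G' a b :
  eq_mod_eps2 F G -> eq_mod_eps2 F' G' ->
  eq_mod_eps2 (fun e => F e * a + F' e * b) (fun e => G e * a + G' e * b).
Proof.
  intros [M H] [M' H']; exists (M * Rabs a + M' * Rabs b).
  apply filter_imp with (2 := filter_and _ _ H H').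
  intros e [He He'].
  replace (F e * a + F' e * b - (G e * a + G' e * b))
    with ((F e - G e) * a + (F' e - G' e) * b) by ring.
  apply Rle_trans with (1 := Rabs_triang _ _); rewrite !Rabs_mult.
  pose proof (Rabs_pos a); pose proof (Rabs_pos b); nra.
Qed.

Lemma eq_mod_eps2_trans F G H :
  eq_mod_eps2 F G -> eq_mod_eps2 G H -> eq_mod_eps2 F H.
Proof.
  intros [M HM] [N HN]; exists (M + N).
  apply filter_imp with (2 := filter_and _ _ HM HN); intros e [H1 H2].
  replace (F e - H e) with ((F e - G e) + (G e - H e)) by ring.
  apply Rle_trans with (1 := Rabs_triang _ _); lra.
Qed.

Lemma eq_mod_eps2_of_quadratic F G a :
  (forall e, F e - G e = a * e ^ 2) -> eq_mod_eps2 F G.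
Proof.
  intros E; exists (Rabs a); apply filter_forall; intros e.
  rewrite E, Rabs_mult, (Rabs_pos_eq (e ^ 2)); [lra | nra].
Qed.

(** The tool that extracts linearized equations: a difference that is O(eps^2)
    vanishes with its derivative at [0]. *)
Lemma eq_mod_eps2_derive F G a b :
  eq_mod_eps2 F G -> is_derive F 0 a -> is_derive G 0 b -> a = b.
Proof.
  intros [M [d Hd]] HF HG.
  assert (Hd' : forall e, Rabs e < d -> Rabs (F e - G e) <= M * e ^ 2).
  { intros e He; apply Hd; change (Rabs (e - 0) < d); now rewrite Rminus_0_r. }
  assert (HD : is_derive (fun e => F e - G e) 0 (a - b))
    by (apply (is_derive_minus (V := R_NormedModule)); assumption).
  assert (H0 : F 0 - G 0 = 0).
  { pose proof (Hd' 0) as H; rewrite Rabs_R0 in H; specialize (H (cond_pos d)).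
    pose proof (Rabs_pos (F 0 - G 0)).
    destruct (Req_dec (F 0 - G 0) 0) as [E | E]; [exact E |].
    apply Rabs_pos_lt in E; nra. }
  apply is_derive_Reals in HD.
  cut (derivable_pt_lim (fun e => F e - G e) 0 0).
  { intros HD0; pose proof (uniqueness_limite _ _ _ _ HD HD0); lra. }
  intros eps Heps; pose proof (Rabs_pos M) as HM.
  assert (Hr : 0 < Rmin d (eps / (Rabs M + 1))).
  { apply Rmin_pos; [apply cond_pos | apply Rdiv_lt_0_compat; lra]. }
  exists (mkposreal _ Hr); intros k Hk Hkr; simpl in Hkr.
  assert (Hk1 : Rabs k < d) by (eapply Rlt_le_trans; [exact Hkr | apply Rmin_l]).
  assert (Hk2 : Rabs k < eps / (Rabs M + 1))
    by (eapply Rlt_le_trans; [exact Hkr | apply Rmin_r]).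
  apply Rlt_div_r in Hk2; [| lra].
  rewrite Rplus_0_l, H0, !Rminus_0_r.
  unfold Rdiv; rewrite Rabs_mult, Rabs_inv.
  pose proof (Rabs_pos_lt k Hk) as Hka; pose proof (Hd' k Hk1) as Hb.
  apply (Rmult_lt_reg_r (Rabs k)); [exact Hka |].
  rewrite Rmult_assoc, Rinv_l, Rmult_1_r by lra.
  apply Rle_lt_trans with (1 := Hb).
  rewrite <- (pow2_abs k); pose proof (Rle_abs M); nra.
Qed.

(** The remainder is [e ^ 2] times a power series of the same radius, which is
    continuous and so bounded near [0]. *)
Lemma PSeries_mod_eps2 (a : nat -> R) :
  Rbar_lt 0 (CV_radius a) ->
  eq_mod_eps2 (fun e => PSeries a e) (fun e => a 0%nat + e * a 1%nat).
Proof.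
  intros Hr; set (b := PS_decr_1 (PS_decr_1 a)).
  assert (Hb : continuous (PSeries b) 0).
  { apply continuity_pt_filterlim, PSeries_continuity; unfold b.
    now rewrite !CV_radius_decr_1, Rabs_R0. }
  exists (Rabs (PSeries b 0) + 1).
  assert (Hlt : locally 0 (fun e => Rbar_lt (Rabs e) (CV_radius a))).
  { destruct (CV_radius a) as [r | |]; simpl in Hr |- *; [| now apply filter_forall | easy].
    exists (mkposreal r Hr); intros e He; change (Rabs (e - 0) < r) in He.
    now rewrite Rminus_0_r in He. }
  pose proof (proj1 (filterlim_locally _ _) Hb (mkposreal 1 Rlt_0_1)) as Hb1.
  apply filter_imp with (2 := filter_and _ _ Hlt Hb1); intros e [He1 He2].
  change (Rabs (PSeries b e - PSeries b 0) < 1) in He2.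
  rewrite (PSeries_decr_1 a) by now apply CV_radius_inside.
  rewrite (PSeries_decr_1 (PS_decr_1 a))
    by (apply CV_radius_inside; now rewrite CV_radius_decr_1).
  fold b; change (PS_decr_1 a 0%nat) with (a 1%nat).
  replace (a 0%nat + e * (a 1%nat + e * PSeries b e) - (a 0%nat + e * a 1%nat))
    with (PSeries b e * e ^ 2) by ring.
  rewrite Rabs_mult, (Rabs_pos_eq (e ^ 2)) by nra.
  apply Rmult_le_compat_r; [nra |].
  replace (PSeries b e) with ((PSeries b e - PSeries b 0) + PSeries b 0) by ring.
  apply Rle_trans with (1 := Rabs_triang _ _); lra.
Qed.

(** * Matrix exponentials to first order *)

Lemma entry_mult (A B : mat2) i j : (i < 2)%nat -> (j < 2)%nat ->
  entry (mult A B) i j = entry A i 0 * entry B 0 j + entry A i 1 * entry B 1 j.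
Proof.
  intros Hi Hj; unfold entry.
  transitivity (coeff_mat 0 (Mmult (T := R_Ring) A B) i j); [reflexivity |].
  unfold Mmult; rewrite coeff_mat_bij by assumption; simpl pred.
  rewrite sum_Sn, sum_O; reflexivity.
Qed.

Lemma entry_one i j : (i < 2)%nat -> (j < 2)%nat ->
  entry (one : mat2) i j = if Nat.eqb i j then 1 else 0.
Proof.
  intros Hi Hj; do 2 (destruct i as [| i]; [do 2 (destruct j as [| j]; [reflexivity |]); lia |]);
    lia.
Qed.

Lemma entry_pow_bound (A : mat2) K n :
  (forall i j, (i < 2)%nat -> (j < 2)%nat -> Rabs (entry A i j) <= K) ->
  forall i j, (i < 2)%nat -> (j < 2)%nat -> Rabs (entry (pow_n A n) i j) <= (2 * K) ^ n.
Proof.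
  intros HK; induction n as [| n IH]; intros i j Hi Hj.
  - simpl pow_n; rewrite entry_one by assumption; simpl.
    destruct (Nat.eqb i j); rewrite ?Rabs_R1, ?Rabs_R0; lra.
  - simpl pow_n; rewrite entry_mult by assumption.
    apply Rle_trans with (1 := Rabs_triang _ _); rewrite !Rabs_mult.
    assert (Hs : forall l, (l < 2)%nat ->
              Rabs (entry A i l) * Rabs (entry (pow_n A n) l j) <= K * (2 * K) ^ n).
    { intros l Hl; apply Rmult_le_compat; try apply Rabs_pos; auto. }
    pose proof (Hs 0%nat ltac:(lia)); pose proof (Hs 1%nat ltac:(lia)); simpl; lra.
Qed.

(** The entries of [A ^ n] are at most [(2 K) ^ n], so the exponential series has
    radius of convergence at least [1 / (2 K)], which is positive. *)
Lemma exp_mat_mod_eps2 (A : mat2) i j : (i < 2)%nat -> (j < 2)%nat ->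
  eq_mod_eps2 (fun e => entry (exp_mat e A) i j)
              (fun e => (if Nat.eqb i j then 1 else 0) + e * entry A i j).
Proof.
  intros Hi Hj.
  set (a := fun n => entry (pow_n A n) i j / INR (fact n)).
  assert (E0 : a 0%nat = if Nat.eqb i j then 1 else 0).
  { unfold a; simpl pow_n; rewrite entry_one by assumption; simpl; field. }
  assert (E1 : a 1%nat = entry A i j).
  { unfold a; simpl pow_n; rewrite mult_one_r; simpl; field. }
  rewrite <- E0, <- E1.
  apply eq_mod_eps2_trans with (fun e => PSeries a e).
  { apply (eq_mod_eps2_of_quadratic _ _ 0); intros e.
    unfold entry at 1, exp_mat; rewrite coeff_mat_bij by assumption.
    fold a; ring. }
  apply PSeries_mod_eps2.
  set (K := Rabs (entry A 0 0) + Rabs (entry A 0 1)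
            + Rabs (entry A 1 0) + Rabs (entry A 1 1) + 1).
  assert (HK : 1 <= K /\ forall i j, (i < 2)%nat -> (j < 2)%nat -> Rabs (entry A i j) <= K).
  { pose proof (Rabs_pos (entry A 0 0)); pose proof (Rabs_pos (entry A 0 1)).
    pose proof (Rabs_pos (entry A 1 0)); pose proof (Rabs_pos (entry A 1 1)).
    split; [unfold K; lra |].
    intros [| [| i']] [| [| j']] ? ?; try lia; unfold K; lra. }
  destruct HK as [HK1 HK].
  assert (Hle : Rbar_le (/ (2 * K)) (CV_radius a)).
  { apply (proj1 (CV_radius_bounded a)); exists 1; intros n.
    unfold a, Rdiv.
    rewrite !Rabs_mult, (Rabs_pos_eq ((/ (2 * K)) ^ n)).
    2:{ apply pow_le; left; apply Rinv_0_lt_compat; lra. }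
    assert (Hf : 1 <= INR (fact n)).
    { change 1 with (INR 1); apply le_INR, lt_O_fact. }
    rewrite (Rabs_pos_eq (/ INR (fact n))) by (left; apply Rinv_0_lt_compat; lra).
    apply Rle_trans with ((2 * K) ^ n * 1 * (/ (2 * K)) ^ n).
    - apply Rmult_le_compat_r; [apply pow_le; left; apply Rinv_0_lt_compat; lra |].
      apply Rmult_le_compat.
      + apply Rabs_pos.
      + left; apply Rinv_0_lt_compat; lra.
      + now apply entry_pow_bound.
      + rewrite <- Rinv_1; apply Rinv_le_contravar; lra.
    - rewrite Rmult_1_r, <- Rpow_mult_distr, Rinv_r, pow1 by lra; lra. }
  apply Rbar_lt_le_trans with (2 := Hle); simpl; apply Rinv_0_lt_compat; lra.
Qed.

(** * Deformations of the circle *)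

Lemma smooth_of_closed_class (S : (R -> R) -> Prop) :
  (forall f, S f -> exists df, S df /\ forall t, is_derive f t (df t)) ->
  forall f, S f -> forall n t, ex_derive_n f n t.
Proof.
  intros HS f Hf.
  assert (H : forall n, exists fn, S fn /\ forall t, Derive_n f n t = fn t).
  { induction n as [| n (fn & Hfn & E)]; [now exists f |].
    destruct (HS fn Hfn) as (df & Hdf & Hd); exists df; split; [exact Hdf |].
    intros t; simpl; rewrite (Derive_ext _ fn) by exact E.
    now apply is_derive_unique. }
  intros [| n] t; [exact I |].
  destruct (H n) as (fn & Hfn & E); destruct (HS fn Hfn) as (df & _ & Hd).
  apply (ex_derive_ext fn); [now intros | now exists (df t)].
Qed.

(** A class closed under differentiation that contains the coordinates of the
    circle and of the deformations [circle_deformation] below. *)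
Definition modulated_wave (w : R) (f : R -> R) : Prop :=
  exists a b c d, forall t,
    f t = (a * cos (w * t) + b * sin (w * t)) * cos t
          + (c * cos (w * t) + d * sin (w * t)) * sin t.

Lemma smooth_modulated_wave w f n t : modulated_wave w f -> ex_derive_n f n t.
Proof.
  intros Hf; apply (smooth_of_closed_class (modulated_wave w)); [| exact Hf]; clear.
  intros f (a & b & c & d & E).
  exists (fun t => ((w * b + c) * cos (w * t) + (d - w * a) * sin (w * t)) * cos t
            + ((w * d - a) * cos (w * t) + (- w * c - b) * sin (w * t)) * sin t).
  split; [now repeat eexists |].
  intros t; apply (is_derive_ext (fun t =>
    (a * cos (w * t) + b * sin (w * t)) * cos t
    + (c * cos (w * t) + d * sin (w * t)) * sin t)); [now intros |].
  auto_derive; [trivial | ring].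
Qed.

Lemma self_backlund_circle alpha :
  0 < alpha < PI -> self_backlund circle alpha (sin alpha).
Proof.
  intros Ha; unfold self_backlund, centroaffine, circle, antiperiodic, det2, velocity;
    simpl fst; simpl snd.
  split; [split |]; [| | split; [| split; [exact Ha | split]]].
  - intros n t; split; apply (smooth_modulated_wave 0).
    + exists 1, 0, 0, 0; intros s; replace (0 * s) with 0 by ring; rewrite cos_0; simpl; ring.
    + exists 0, 0, 1, 0; intros s; replace (0 * s) with 0 by ring; rewrite cos_0; simpl; ring.
  - intros t.
    assert (Ec : Derive (fun s => cos s) t = - sin t)
      by apply is_derive_unique, is_derive_cos.
    assert (Es : Derive (fun s => sin s) t = cos t)
      by apply is_derive_unique, is_derive_sin.
    rewrite Ec, Es; pose proof (sin2_cos2 t) as H; unfold Rsqr in H; lra.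
  - intros t; rewrite neg_cos, neg_sin; reflexivity.
  - pose proof (sin_gt_0 alpha (proj1 Ha) (proj2 Ha)); lra.
  - intros t; replace alpha with (t + alpha - t) at 3 by ring.
    rewrite sin_minus; ring.
Qed.

Lemma velocity_deformed_circle g1 e t :
  ex_derive (fun s => fst (g1 s)) t -> ex_derive (fun s => snd (g1 s)) t ->
  velocity (deformed circle g1 e) t =
  (- sin t + e * fst (velocity g1 t), cos t + e * snd (velocity g1 t)).
Proof.
  set (x := fun s => fst (g1 s)); set (y := fun s => snd (g1 s)); intros Hx Hy.
  unfold velocity at 1; f_equal; apply is_derive_unique.
  - change (is_derive (fun s => cos s + e * x s) t (- sin t + e * Derive x t)).
    auto_derive; [auto | unfold Derive; ring].
  - change (is_derive (fun s => sin s + e * y s) t (cos t + e * Derive y t)).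
    auto_derive; [auto | unfold Derive; ring].
Qed.

(** The frame coordinates of a field [g1] along the circle: [radial] along the
    position vector and [tangential] along the velocity. *)
Definition radial (g1 : R -> R * R) (t : R) : R :=
  fst (g1 t) * cos t + snd (g1 t) * sin t.
Definition tangential (g1 : R -> R * R) (t : R) : R :=
  cos t * snd (g1 t) - sin t * fst (g1 t).

Lemma frame_coordinates g1 t :
  g1 t = (radial g1 t * cos t - tangential g1 t * sin t,
          radial g1 t * sin t + tangential g1 t * cos t).
Proof.
  pose proof (sin2_cos2 t) as H; unfold Rsqr in H.
  rewrite (surjective_pairing (g1 t)) at 1; unfold radial, tangential.
  set (x := fst (g1 t)); set (y := snd (g1 t)).
  f_equal; [transitivity (x * (sin t * sin t + cos t * cos t)); [rewrite H |]
           | transitivity (y * (sin t * sin t + cos t * cos t)); [rewrite H |]]; ring.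
Qed.

Lemma frame_coordinates_periodic g1 :
  antiperiodic g1 -> periodic (radial g1) /\ periodic (tangential g1).
Proof.
  intros H; split; intros t; unfold radial, tangential; rewrite (H t), neg_cos, neg_sin;
    change (fst (opp (g1 t))) with (- fst (g1 t));
    change (snd (opp (g1 t))) with (- snd (g1 t)); ring.
Qed.

(** Differentiating the two defining equations at [eps = 0].  A change [alpha1] of
    the rotation number only shifts the constant [C]. *)
Lemma infinitesimal_deformation_frame alpha g1 :
  infinitesimal_deformation circle alpha g1 ->
  (forall t, is_derive (tangential g1) t (-2 * radial g1 t)) /\
  (forall t, continuous (radial g1) t) /\
  exists C, forall t,
    sin alpha * (radial g1 t + radial g1 (t + alpha))
    + cos alpha * (tangential g1 (t + alpha) - tangential g1 t) = C.
Proof.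
  intros (Hs & _ & H1 & c & alpha1 & c1 & _ & H2).
  set (x := fun s => fst (g1 s)); set (y := fun s => snd (g1 s)).
  assert (Hx : forall t, ex_derive x t) by (intros t; apply (Hs 1%nat t)).
  assert (Hy : forall t, ex_derive y t) by (intros t; apply (Hs 1%nat t)).
  change (tangential g1) with (fun t => cos t * y t - sin t * x t).
  change (radial g1) with (fun t => x t * cos t + y t * sin t).
  split; [| split].
  - intros t.
    assert (E : cos t * Derive y t + x t * cos t - (sin t * Derive x t - y t * sin t) = 0).
    { apply (eq_mod_eps2_derive _ _ _ _ (H1 t)).
      - apply (is_derive_ext (fun e => (cos t + e * x t) * (cos t + e * Derive y t)
                                - (sin t + e * y t) * (- sin t + e * Derive x t))).
        { intros e; rewrite velocity_deformed_circle; [reflexivity | apply Hx | apply Hy]. }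
        auto_derive; [trivial | ring].
      - apply (is_derive_const (K := R_AbsRing) (V := R_NormedModule)). }
    replace (-2 * (x t * cos t + y t * sin t))
      with (- sin t * y t + cos t * Derive y t - (cos t * x t + sin t * Derive x t)) by lra.
    auto_derive; [auto | unfold Derive; ring].
  - intros t; apply (ex_derive_continuous (V := R_NormedModule)).
    auto_derive; auto.
  - exists (c1 - alpha1 * cos alpha); intros t.
    set (u := t + alpha).
    assert (E : x t * sin u - y t * cos u
                + cos t * (cos u * alpha1 + y u)
                - sin t * (- sin u * alpha1 + x u) = c1).
    { apply (eq_mod_eps2_derive _ _ _ _ (H2 t)).
      - apply (is_derive_ext (fun e =>
          (cos t + e * x t)
            * (sin (t + (alpha + e * alpha1)) + e * y (t + (alpha + e * alpha1)))
          - (sin t + e * y t)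
            * (cos (t + (alpha + e * alpha1)) + e * x (t + (alpha + e * alpha1)))));
          [reflexivity |].
        auto_derive; [auto |].
        rewrite !Rmult_0_l, !Rplus_0_r; fold u; ring.
      - auto_derive; [trivial | ring]. }
    assert (Ha : alpha = u - t) by (unfold u; ring).
    rewrite <- E, Ha,  sin_minus, cos_minus.
    pose proof (sin2_cos2 t) as St; pose proof (sin2_cos2 u) as Su; unfold Rsqr in St, Su.
    transitivity (x t * sin u * (sin t * sin t + cos t * cos t)
                  - y t * cos u * (sin t * sin t + cos t * cos t)
                  + cos t * y u * (sin u * sin u + cos u * cos u)
                  - sin t * x u * (sin u * sin u + cos u * cos u)); [ring |].
    rewrite St, Su; ring.
Qed.

(** Back in Cartesian coordinates such a field is linear, with the trace-free matrix
    of rows [(- q, p - A)] and [(p + A, q)]: the harmonic 0 is the rotation and the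
    harmonic 1 the symmetric part of sl2. *)
Lemma first_harmonic_trivial g1 A p q :
  (forall t, is_derive (tangential g1) t (-2 * radial g1 t)) ->
  (forall t, tangential g1 t = A + p * cos (2 * t) + q * sin (2 * t)) ->
  trivial_deformation circle g1.
Proof.
  intros Hd E; right.
  assert (Er : forall t, radial g1 t = p * sin (2 * t) - q * cos (2 * t)).
  { intros t.
    assert (H : is_derive (tangential g1) t (-2 * p * sin (2 * t) + 2 * q * cos (2 * t))).
    { apply (is_derive_ext (fun t => A + p * cos (2 * t) + q * sin (2 * t)));
        [now intros |]. auto_derive; [trivial | ring]. }
    apply is_derive_unique in H; pose proof (is_derive_unique _ _ _ (Hd t)); lra. }
  exists (mk_matrix 2 2 (fun i j => match i, j with
    | O, O => - q | O, _ => p - A | _, O => p + A | _, _ => q end)).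
  split; [unfold in_sl2; simpl; unfold entry; rewrite !coeff_mat_bij by lia; ring |].
  set (B := mk_matrix 2 2 _); intros t.
  assert (Hg : g1 t = (- q * cos t + (p - A) * sin t, (p + A) * cos t + q * sin t)).
  { rewrite frame_coordinates, Er, E, sin_2a, cos_2a.
    pose proof (sin2_cos2 t) as H; unfold Rsqr in H.
    f_equal.
    - transitivity (- q * cos t * (sin t * sin t + cos t * cos t)
                    + (p * (sin t * sin t + cos t * cos t) - A) * sin t); [ring |].
      rewrite H; ring.
    - transitivity ((p * (sin t * sin t + cos t * cos t) + A) * cos t
                    + q * sin t * (sin t * sin t + cos t * cos t)); [ring |].
      rewrite H; ring. }
  assert (HB : entry B 0 0 = - q /\ entry B 0 1 = p - A /\
               entry B 1 0 = p + A /\ entry B 1 1 = q) by (repeat split; reflexivity).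
  destruct HB as (B00 & B01 & B10 & B11).
  split; apply eq_mod_eps2_sym.
  - apply eq_mod_eps2_trans with (fun e => (1 + e * - q) * cos t + (0 + e * (p - A)) * sin t).
    + rewrite <- B00, <- B01; apply eq_mod_eps2_lin; apply (exp_mat_mod_eps2 B); lia.
    + apply (eq_mod_eps2_of_quadratic _ _ 0); intros e.
      change (fst (deformed circle g1 e t)) with (cos t + e * fst (g1 t)).
      rewrite Hg; simpl; ring.
  - apply eq_mod_eps2_trans with (fun e => (0 + e * (p + A)) * cos t + (1 + e * q) * sin t).
    + rewrite <- B10, <- B11; apply eq_mod_eps2_lin; apply (exp_mat_mod_eps2 B); lia.
    + apply (eq_mod_eps2_of_quadratic _ _ 0); intros e.
      change (snd (deformed circle g1 e t)) with (sin t + e * snd (g1 t)).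
      rewrite Hg; simpl; ring.
Qed.

(** A shift of the argument of the circle is a rotation, so that both kinds of
    trivial deformation are linear fields. *)
Lemma trivial_deformation_linear g1 :
  trivial_deformation circle g1 ->
  exists a b c d, forall t, g1 t = (a * cos t + b * sin t, c * cos t + d * sin t).
Proof.
  assert (Hdef : forall t (F : R -> R * R) (x y : R),
    eq_mod_eps2_plane (fun e => deformed circle g1 e t) F ->
    is_derive (fun e => fst (F e)) 0 x -> is_derive (fun e => snd (F e)) 0 y ->
    g1 t = (x, y)).
  { intros t F x y [H1 H2] Hx Hy; rewrite (surjective_pairing (g1 t)); f_equal.
    - apply (eq_mod_eps2_derive _ _ _ _ H1); [| exact Hx].
      change (is_derive (fun e => cos t + e * fst (g1 t)) 0 (fst (g1 t))).
      auto_derive; [trivial | ring].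
    - apply (eq_mod_eps2_derive _ _ _ _ H2); [| exact Hy].
      change (is_derive (fun e => sin t + e * snd (g1 t)) 0 (snd (g1 t))).
      auto_derive; [trivial | ring]. }
  intros [[a Ha] | (A & _ & HA)].
  - exists 0, (- a), a, 0; intros t; apply (Hdef t _ _ _ (Ha t)); simpl;
      auto_derive; trivial; rewrite Rmult_0_r, Rplus_0_r; ring.
  - exists (entry A 0 0), (entry A 0 1), (entry A 1 0), (entry A 1 1); intros t.
    apply (Hdef t (fun e => ((1 + e * entry A 0 0) * cos t + (0 + e * entry A 0 1) * sin t,
                             (0 + e * entry A 1 0) * cos t + (1 + e * entry A 1 1) * sin t)));
      [| simpl; auto_derive; [trivial | ring] | simpl; auto_derive; [trivial | ring]].
    destruct (HA t) as [H1 H2]; split.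
    + apply eq_mod_eps2_trans with (1 := H1); simpl.
      apply eq_mod_eps2_lin; apply (exp_mat_mod_eps2 A); lia.
    + apply eq_mod_eps2_trans with (1 := H2); simpl.
      apply eq_mod_eps2_lin; apply (exp_mat_mod_eps2 A); lia.
Qed.

(** The field with tangential part [cos (2 k t)]; the radial part is minus half the
    derivative of the latter, so that the area condition holds to first order. *)
Definition circle_deformation (k : nat) (t : R) : R * R :=
  (INR k * sin (2 * INR k * t) * cos t - cos (2 * INR k * t) * sin t,
   INR k * sin (2 * INR k * t) * sin t + cos (2 * INR k * t) * cos t).

Lemma circle_deformation_infinitesimal k alpha :
  0 < alpha < PI -> dispersion k alpha = 0 ->
  infinitesimal_deformation circle alpha (circle_deformation k).
Proof.
  intros Ha HD.
  assert (Hs : smooth_curve (circle_deformation k)).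
  { intros n t; split; apply (smooth_modulated_wave (2 * INR k)).
    - exists 0, (INR k), (-1), 0; intros s; simpl; ring.
    - exists 1, 0, 0, (INR k); intros s; simpl; ring. }
  split; [exact Hs |]; split; [| split].
  - intros t; unfold circle_deformation; rewrite neg_cos, neg_sin.
    replace (2 * INR k * (t + PI)) with (2 * INR k * t + 2 * INR k * PI) by ring.
    rewrite cos_period, sin_period.
    change opp with (fun z : R * R => (- fst z, - snd z)); simpl; f_equal; ring.
  - intros t; apply (eq_mod_eps2_of_quadratic _ _
      (det2 (circle_deformation k t) (velocity (circle_deformation k) t))); intros e.
    rewrite velocity_deformed_circle by apply (Hs 1%nat t).
    change (deformed circle (circle_deformation k) e t) with
      (cos t + e * fst (circle_deformation k t), sin t + e * snd (circle_deformation k t)).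
    assert (Ev : velocity (circle_deformation k) t =
      (INR k * (2 * INR k * cos (2 * INR k * t)) * cos t
       - INR k * sin (2 * INR k * t) * sin t
       - (- (2 * INR k * sin (2 * INR k * t)) * sin t + cos (2 * INR k * t) * cos t),
       INR k * (2 * INR k * cos (2 * INR k * t)) * sin t
       + INR k * sin (2 * INR k * t) * cos t
       + (- (2 * INR k * sin (2 * INR k * t)) * cos t - cos (2 * INR k * t) * sin t))).
    { unfold velocity, circle_deformation; simpl.
      f_equal; apply is_derive_unique; auto_derive; trivial; ring. }
    rewrite Ev.
    pose proof (sin2_cos2 t) as H; unfold Rsqr in H.
    unfold det2, circle_deformation; simpl fst; simpl snd.
    rewrite <- H; ring.
  - exists (sin alpha), 0, 0; split; [now apply self_backlund_circle |].
    intros t; apply (eq_mod_eps2_of_quadratic _ _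
      (det2 (circle_deformation k t) (circle_deformation k (t + alpha)))); intros e.
    rewrite Rmult_0_r, Rplus_0_r.
    set (u := t + alpha).
    change (deformed circle (circle_deformation k) e t) with
      (cos t + e * fst (circle_deformation k t), sin t + e * snd (circle_deformation k t)).
    change (deformed circle (circle_deformation k) e u) with
      (cos u + e * fst (circle_deformation k u), sin u + e * snd (circle_deformation k u)).
    assert (Es : sin alpha = sin u * cos t - cos u * sin t)
      by (rewrite <- sin_minus; unfold u; f_equal; ring).
    assert (Ec : cos alpha = cos u * cos t + sin u * sin t)
      by (rewrite <- cos_minus; unfold u; f_equal; ring).
    (* The two arguments are symmetric about [mid], at distance [k alpha]. *)
    set (mid := 2 * INR k * t + INR k * alpha).
    assert (E : sin alpha * INR k * (sin (2 * INR k * t) + sin (2 * INR k * u))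
                + cos alpha * (cos (2 * INR k * u) - cos (2 * INR k * t)) = 0).
    { replace (2 * INR k * t) with (mid - INR k * alpha) by (unfold mid; ring).
      replace (2 * INR k * u) with (mid + INR k * alpha) by (unfold mid, u; ring).
      rewrite sin_plus, sin_minus, cos_plus, cos_minus.
      transitivity (2 * sin mid * dispersion k alpha); [unfold dispersion; ring |].
      rewrite HD; ring. }
    rewrite Es, Ec in E; rewrite Es.
    unfold det2, circle_deformation; simpl fst; simpl snd.
    match goal with |- ?l = ?r =>
      transitivity (r + e * ((sin u * cos t - cos u * sin t) * INR k
          * (sin (2 * INR k * t) + sin (2 * INR k * u))
        + (cos u * cos t + sin u * sin t)
          * (cos (2 * INR k * u) - cos (2 * INR k * t)))); [ring | rewrite E; ring] end.
Qed.

(** A linear field has for tangential part a quadratic form in [(cos t, sin t)].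
    [cos (2 k t)] equals 1 at [0], [PI / k] and [2 PI / k], three distinct lines when
    [3 <= k], which would force the form to be 1 on the whole circle; but
    [cos (2 k t)] takes the value -1 at [PI / (2 k)]. *)
Lemma circle_deformation_nontrivial k :
  (3 <= k)%nat -> ~ trivial_deformation circle (circle_deformation k).
Proof.
  intros Hk H; pose proof PI_RGT_0 as HPI.
  destruct (trivial_deformation_linear _ H) as (a & b & c & d & E); clear H.
  assert (HK : 3 <= INR k) by (replace 3 with (INR 3) by (simpl; ring); now apply le_INR).
  assert (Hq : forall t, cos (2 * INR k * t)
                         = c * (cos t * cos t) + (d - a) * (cos t * sin t) - b * (sin t * sin t)).
  { intros t.
    transitivity (tangential (circle_deformation k) t).
    - pose proof (sin2_cos2 t) as H; unfold Rsqr in H.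
      unfold tangential, circle_deformation; simpl fst; simpl snd.
      transitivity (cos (2 * INR k * t) * (sin t * sin t + cos t * cos t)); [rewrite H |]; ring.
    - unfold tangential; rewrite E; simpl; ring. }
  assert (Hc : c = 1).
  { pose proof (Hq 0) as H; rewrite Rmult_0_r, cos_0, sin_0 in H; lra. }
  set (x := PI / INR k).
  assert (Hx : 0 < x /\ 2 * x < PI).
  { unfold x; split; [apply Rdiv_lt_0_compat; lra |].
    replace (2 * (PI / INR k)) with (2 * PI / INR k) by (field; lra).
    apply Rlt_div_l; nra. }
  assert (Hline : forall m, 0 < sin (INR m * x) ->
            (d - a) * cos (INR m * x) = (b + 1) * sin (INR m * x)).
  { intros m Hs; pose proof (Hq (INR m * x)) as H.
    replace (2 * INR k * (INR m * x)) with (0 + 2 * INR m * PI) in H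
      by (unfold x; field; lra).
    rewrite cos_period, cos_0, Hc in H.
    pose proof (sin2_cos2 (INR m * x)) as H2; unfold Rsqr in H2.
    apply (Rmult_eq_reg_r (sin (INR m * x))); lra. }
  pose proof (Hline 1%nat) as L1; pose proof (Hline 2%nat) as L2; clear Hline.
  simpl INR in L1, L2; rewrite Rmult_1_l in L1.
  assert (Hs1 : 0 < sin x) by (apply sin_gt_0; lra).
  assert (Hs2 : 0 < sin ((1 + 1) * x)) by (apply sin_gt_0; lra).
  specialize (L1 Hs1); specialize (L2 Hs2).
  assert (Hda : d - a = 0).
  { apply (Rmult_eq_reg_r (sin x)); [| lra].
    replace (sin x) with (sin ((1 + 1) * x - x)) at 1 by (f_equal; ring).
    rewrite sin_minus, Rmult_0_l.
    transitivity (sin ((1 + 1) * x) * ((d - a) * cos x)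
                  - sin x * ((d - a) * cos ((1 + 1) * x))); [ring |].
    rewrite L1, L2; ring. }
  assert (Hb : b + 1 = 0).
  { apply (Rmult_eq_reg_r (sin x)); [| lra]; rewrite <- L1, Hda; ring. }
  pose proof (Hq (x / 2)) as H.
  replace (2 * INR k * (x / 2)) with PI in H by (unfold x; field; lra).
  rewrite cos_PI, Hc, Hda in H.
  pose proof (sin2_cos2 (x / 2)) as H2; unfold Rsqr in H2.
  replace b with (-1) in H by lra; lra.
Qed.

Theorem theorem3 :
  (forall alpha : R, 0 < alpha < PI ->
     ((exists g1 : R -> R * R,
         infinitesimal_deformation circle alpha g1 /\
         ~ trivial_deformation circle g1)
      <->
      (alpha = PI / 2 \/
       (alpha <> PI / 2 /\ exists k : nat, (4 <= k)%nat /\ tan_equation k alpha))))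
  /\
  (forall k : nat, (2 <= k)%nat ->
     exists sols : list R,
       NoDup sols /\ length sols = (k - 2)%nat /\
       forall alpha : R,
         In alpha sols <->
         (0 < alpha < PI /\
          (tan_equation k alpha \/ (Nat.Odd k /\ alpha = PI / 2)))).
Proof.
  split.
  - intros alpha Ha; split.
    + intros (g1 & Hg & Hnt).
      destruct (Req_dec alpha (PI / 2)) as [E | Hne]; [now left | right; split; [exact Hne |]].
      apply NNPP; intros Hno; apply Hnt.
      assert (HD : forall n, (2 <= n)%nat -> dispersion n alpha <> 0).
      { intros n Hn E; destruct (le_lt_dec 4 n) as [H4 | H4].
        - apply Hno; exists n; split; [exact H4 |].
          apply tan_equation_iff_dispersion; [| exact E].
          intros Hc; apply Hne, (cos_eq_0_in_0_PI alpha Ha Hc).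
        - apply Hne, (dispersion_zero_small n); [lia | exact Ha | exact E]. }
      destruct (infinitesimal_deformation_frame alpha g1 Hg) as (Hd & Hr & C & HC).
      destruct (frame_coordinates_periodic g1 (proj1 (proj2 Hg))) as [Pr Pt].
      destruct (linearized_solution (tangential g1) (fun t => -2 * radial g1 t) alpha C)
        as (A & p & q & E); try assumption.
      * intros t; apply (continuous_scal_r (V := R_NormedModule)), Hr.
      * intros t; now rewrite Pr.
      * intros t; rewrite <- (HC t); field.
      * exact (first_harmonic_trivial g1 A p q Hd E).
    + intros H.
      assert (HD : exists k, (3 <= k)%nat /\ dispersion k alpha = 0).
      { destruct H as [-> | (Hne & k & Hk & E)].
        - exists 3%nat; split; [lia |].
          apply dispersion_at_odd_half_PI; exists 1%nat; lia.
        - exists k; split; [lia |].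
          apply tan_equation_iff_dispersion; [apply E | exact E]. }
      destruct HD as (k & Hk & E); exists (circle_deformation k); split.
      * now apply circle_deformation_infinitesimal.
      * now apply circle_deformation_nontrivial.
  - intros k Hk.
    destruct (dispersion_zeros k Hk) as (l & ND & Hl & Hin).
    exists l; split; [exact ND | split; [exact Hl |]].
    intros alpha; rewrite Hin; split; intros [Ha E]; split; try exact Ha.
    + now apply tan_equation_or_half_PI_iff.
    + now apply (tan_equation_or_half_PI_iff k alpha Hk Ha).
Qed.
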